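(* Let $m\in\mathbb{N}$ and let $F=F(x,y)$ be a Finsler metric on $\mathbb{R}^{m+1}$ with arithmetic symmetrization $F_s(x,y):=\frac12(F(x,y)+F(x,-y))$ and antisymmetric part $F_a(x,y):=\frac12(F(x,y)-F(x,-y))$. Suppose that for all $x\in\mathbb{R}^{m+1}$ and $y\in\mathbb{R}^{m+1}\setminus\{0\}$ $$\Big(\sum_{l=1}^{m+1}(F_a)_{y^l}(x,y)w^l\Big)^2<\frac{1}{m+1}\sum_{i,j=1}^{m+1}(g_{F_s})_{ij}(x,y)w^iw^j\quad\text{for all }w\in\mathbb{R}^{m+1}\setminus\{0\},$$ where $(g_{F_s})_{ij}:=(F_s^2/2)_{y^iy^j}$, and that the matrix $\big(F_a(x,y)(F_a)_{y^iy^j}(x,y)\big)_{i,j}$ is negative semi-definite for all $x\in\mathbb{R}^{m+1}$ and $y\in\mathbb{R}^{m+1}\setminus\{0\}$. Then the $m$-harmonic symmetrization $F_{\mathrm{sym}}$ of $F$ is also a Finsler metric on $\mathbb{R}^{m+1}$.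
   Context: A Finsler metric on $\mathbb{R}^{n}$ is a non-negative function $F=F(x,y)$, smooth on $\mathbb{R}^{n}\times(\mathbb{R}^{n}\setminus\{0\})$ (extended by $F(x,0)=0$), such that (F1) $F(x,ty)=tF(x,y)$ for all $t>0$; and (F2) the matrix $(F^2/2)_{y^iy^j}(x,y)$ is positive definite for all $x$ and all $y\neq0$. The $m$-harmonic symmetrization of a Finsler metric $F$ on $\mathbb{R}^{m+1}$ is $$F_{\mathrm{sym}}(x,y):=\left[\frac{2}{F^{-m}(x,y)+F^{-m}(x,-y)}\right]^{1/m}\ (y\ne0),\qquad F_{\mathrm{sym}}(x,0)=0.$$ *)

(* Defs.v *)
From HB Require Import structures.
From mathcomp Require Import all_boot all_order all_algebra.
From mathcomp Require Import all_classical all_reals all_analysis.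
Set Implicit Arguments.
Unset Strict Implicit.
Unset Printing Implicit Defensive.
Import Order.TTheory GRing.Theory Num.Theory.
Import numFieldNormedType.Exports.
Local Open Scope classical_set_scope.
Local Open Scope ring_scope.

Section Smooth.
Context (R : realType) (V : normedModType R).

(* Meaningful for open A and finite-dimensional V, where f is C^(k+1) on A iff
   f is differentiable on A with all its directional derivatives C^k on A. *)
Fixpoint is_Ck (k : nat) (A : set V) (f : V -> R) : Prop :=
  match k with
  | 0%N => forall p, A p -> {for p, continuous f}
  | k'.+1 => (forall p, A p -> differentiable f p) /\
             (forall v : V, is_Ck k' A ('D_v f))
  end.

Definition smooth_on (A : set V) (f : V -> R) : Prop :=
  forall k, is_Ck k A f.

End Smooth.

Section Finsler.
Context (R : realType).

Definition partial n (l : 'I_n) (f : 'rV[R]_n -> R) : 'rV[R]_n -> R :=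
  'D_(delta_mx 0 l) f.

Definition hessian n (f : 'rV[R]_n -> R) (y : 'rV[R]_n) : 'M[R]_n :=
  \matrix_(i, j) partial j (partial i f) y.

(* Only applied to Hessians of smooth functions, which are symmetric. *)
Definition posdef n (A : 'M[R]_n) : Prop :=
  forall w : 'rV[R]_n, w != 0 -> 0 < \sum_i \sum_j A i j * w 0 i * w 0 j.

Definition negsemidef n (A : 'M[R]_n) : Prop :=
  forall w : 'rV[R]_n, \sum_i \sum_j A i j * w 0 i * w 0 j <= 0.

Definition fundamental_tensor n (F : 'rV[R]_n -> 'rV[R]_n -> R)
    (x y : 'rV[R]_n) : 'M[R]_n :=
  hessian (fun z => F x z ^+ 2 / 2) y.

Record finsler_metric n (F : 'rV[R]_n -> 'rV[R]_n -> R) : Prop := FinslerMetric {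
  finsler_ge0 : forall x y, 0 <= F x y ;
  finsler_smooth :
    smooth_on [set p : 'rV[R]_n * 'rV[R]_n | p.2 != 0] (fun p => F p.1 p.2) ;
  finsler_0 : forall x, F x 0 = 0 ;
  finsler_homog : forall x y (t : R), 0 < t -> F x (t *: y) = t * F x y ;
  finsler_posdef : forall x y, y != 0 -> posdef (fundamental_tensor F x y)
}.

Definition sym_part n (F : 'rV[R]_n -> 'rV[R]_n -> R) (x y : 'rV[R]_n) : R :=
  2^-1 * (F x y + F x (- y)).

Definition antisym_part n (F : 'rV[R]_n -> 'rV[R]_n -> R) (x y : 'rV[R]_n) : R :=
  2^-1 * (F x y - F x (- y)).

Definition harmonic_sym (m : nat) (F : 'rV[R]_m.+1 -> 'rV[R]_m.+1 -> R)
    (x y : 'rV[R]_m.+1) : R :=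
  if y == 0 then 0
  else (2 / (F x y ^- m + F x (- y) ^- m)) `^ (m%:R^-1).

End Finsler.

(* Main.v *)
Require Import Defs.
From HB Require Import structures.
From mathcomp Require Import all_boot all_order all_algebra.
From mathcomp Require Import all_classical all_reals all_analysis.
From mathcomp Require Import ring lra.
Import Order.TTheory GRing.Theory Num.Theory.
Import numFieldNormedType.Exports.
Set Implicit Arguments.
Unset Strict Implicit.
Unset Printing Implicit Defensive.
Local Open Scope classical_set_scope.
Local Open Scope ring_scope.

(* Fix x and a direction w, and write u = F(x, y), v = F(x, -y), with first and
   second derivatives U, V, U2, V2 along w. On y != 0,
   F_sym^2 / 2 = (1/2) phi^(-2/m) with phi = (u^-m + v^-m) / 2, so positivity of
   the second derivative means phi phi'' < (1 + 2/m) phi'^2. With k = m + 1,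
   X = u^k, Y = v^k this is a quadratic inequality in U, V, U2, V2.
   The condition on F_a F_a'' compares U2 with V2 in the order needed for
   Chebyshev's sum inequality, which replaces the U2, V2 terms by a multiple of
   U2 + V2; the gradient bound then bounds U2 + V2 below by a quadratic form in
   U, V. What remains is a binary quadratic form, which vanishes if u = v and,
   multiplied by u - v, is a sum of squares with coefficients that are
   nonnegative because tanh (k t) <= k tanh t and k sinh (2 t) <= sinh (2 k t),
   where u / v = e^(2 t). *)

(** * Polynomial inequalities in [u], [v] and their powers *)

Section PowerInequalities.
Variable R : realFieldType.
Implicit Types (u v : R) (k m : nat).

(* With u / v = e^(2 t) this reads tanh (k t) <= k tanh t. *)
Lemma exprB_le_exprD k u v : 0 < v -> v <= u ->
  (u ^+ k - v ^+ k) * (u + v) <= k%:R * ((u - v) * (u ^+ k + v ^+ k)).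
Proof.
move=> v0 vu; have u0 : 0 < u := lt_le_trans v0 vu.
elim: k => [|k IH]; first by rewrite !expr0 subrr !mul0r.
have X0 : 0 < u ^+ k by rewrite exprn_gt0.
have Y0 : 0 < v ^+ k by rewrite exprn_gt0.
have XY : v ^+ k <= u ^+ k by rewrite lerXn2r ?nnegrE ?(ltW u0) ?(ltW v0).
rewrite -natr1 !exprS; move: (u ^+ k) (v ^+ k) k%:R X0 Y0 XY IH (ler0n R k).
move=> X Y c X0 Y0 XY IH c0.
have uvXY : 0 <= (u - v) * (X - Y) by rewrite mulr_ge0 ?subr_ge0.
have h : 0 <= c * (u - v) * ((u - v) * (X - Y)).
  by rewrite !mulr_ge0 // subr_ge0.
have h2 : 0 <= (u - v) * ((u - v) * (X - Y)) by rewrite mulr_ge0 // subr_ge0.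
(* The gap for [k + 1] is [(u + v) / 2] times the gap for [k], plus half of [h] and half of [h2]. *)
nra.
Qed.

(* With u / v = e^(2 t) this reads k sinh (2 t) <= sinh (2 k t). *)
Lemma mulr_sqrB_le_exprB k u v : 0 < v -> v <= u ->
  k%:R * ((u ^+ k * v ^+ k) * (u ^+ 2 - v ^+ 2))
  <= (u ^+ k * u ^+ k - v ^+ k * v ^+ k) * (u * v).
Proof.
move=> v0 vu; have u0 : 0 < u := lt_le_trans v0 vu.
elim: k => [|k IH]; first by rewrite !expr0 !mul1r mul0r subrr mul0r.
have X0 : 0 < u ^+ k by rewrite exprn_gt0.
have Y0 : 0 < v ^+ k by rewrite exprn_gt0.
rewrite -natr1 !exprS; move: (u ^+ k) (v ^+ k) k%:R X0 Y0 IH (ler0n R k).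
move=> X Y c X0 Y0 IH c0.
rewrite -subr_ge0.
have uv : 0 <= u - v by rewrite subr_ge0.
set z := (X in 0 <= X).
(* The gap for [k + 1] is [(u ^+ 2 + v ^+ 2) / 2] times the gap for [k], plus two terms that are
   nonnegative because [v <= u]. *)
suff -> : z = (u ^+ 2 + v ^+ 2) / 2 *
    ((X * X - Y * Y) * (u * v) - c * ((X * Y) * (u ^+ 2 - v ^+ 2))) +
    (u ^+ 2 - v ^+ 2) / 2 * (u * v * (X - Y) ^+ 2) +
    c * ((X * Y) * (u ^+ 2 - v ^+ 2)) * (u - v) ^+ 2 / 2.
  have uuvv : 0 <= u ^+ 2 - v ^+ 2 by rewrite subr_sqr mulr_ge0// addr_ge0// ltW.
  have h1 : 0 <= u * v * (X - Y) ^+ 2 by rewrite mulr_ge0 ?sqr_ge0// mulr_ge0// ltW.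
  have h2 : 0 <= c * ((X * Y) * (u ^+ 2 - v ^+ 2)).
    by rewrite !mulr_ge0// ltW.
  have h3 : 0 <= u ^+ 2 + v ^+ 2 by rewrite addr_ge0 ?sqr_ge0.
  rewrite !addr_ge0//; last by rewrite divr_ge0// mulr_ge0// sqr_ge0.
  - by rewrite mulr_ge0 ?divr_ge0// subr_ge0.
  - by rewrite mulr_ge0// divr_ge0.
by rewrite /z; field.
Qed.

(** For [k = m + 1] the conclusion is [phi phi'' < (1 + 2/m) phi'^2], divided by
    [m / (2 u^k v^k)^2]. *)
Lemma harmonic_form_ordered k (u v U V U2 V2 : R) : (0 < k)%N -> 0 < v -> v <= u ->
  (u - v) * (U2 - V2) <= 0 ->
  ((U - V) / 2) ^+ 2
    < k%:R^-1 * ((u + v) / 2 * ((U2 + V2) / 2) + ((U + V) / 2) ^+ 2) ->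
  (u * v ^+ k + v * u ^+ k) *
    (k%:R * (v ^+ k * U ^+ 2 / u + u ^+ k * V ^+ 2 / v)
     - (v ^+ k * U2 + u ^+ k * V2))
  < k.+1%:R * (v ^+ k * U + u ^+ k * V) ^+ 2.
Proof.
move=> k0 v0 vu h2 h1; have u0 : 0 < u := lt_le_trans v0 vu.
have T := @exprB_le_exprD k _ _ v0 vu.
have E := @mulr_sqrB_le_exprB k _ _ v0 vu.
have X0 : 0 < u ^+ k by rewrite exprn_gt0.
have Y0 : 0 < v ^+ k by rewrite exprn_gt0.
have XY : v ^+ k <= u ^+ k by rewrite lerXn2r ?nnegrE ?(ltW u0) ?(ltW v0).
have uvXY : u = v -> u ^+ k = v ^+ k by move->.
have k0' : 0 < k%:R :> R by rewrite ltr0n.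
rewrite -natr1.
(* From here on the powers are arbitrary positive numbers [X] and [Y], tied to [u] and [v] only by
   the facts listed. *)
move: (u ^+ k) (v ^+ k) (k%:R : R) X0 Y0 XY T E uvXY k0' h1.
clear k k0 => X Y k X0 Y0 XY T E uvXY k0.
rewrite ltr_pdivlMl// => h1.
set s : R := (u + v) / 2; set a : R := (u - v) / 2.
set S : R := (U + V) / 2; set A : R := (U - V) / 2; set S2 : R := (U2 + V2) / 2.
have s0 : 0 < s by rewrite divr_gt0// addr_gt0.
have hS2 : 0 < s * S2 + S ^+ 2 - k * A ^+ 2 by rewrite subr_gt0.
set W := u * Y + v * X.
have W0 : 0 < W by rewrite addr_gt0// mulr_gt0.
(* Chebyshev's sum inequality *)
have cheb : (X + Y) * S2 <= Y * U2 + X * V2.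
  suff h : 0 <= (X - Y) * (V2 - U2).
    rewrite -subr_ge0 (_ : _ - _ = (X - Y) * (V2 - U2) / 2) ?divr_ge0//.
    by rewrite /S2; field.
  have [uv|uv] := eqVneq u v; first by rewrite uvXY// subrr mul0r.
  have uv0 : 0 < u - v by rewrite subr_gt0 lt_neqAle eq_sym uv.
  rewrite mulr_ge0 ?subr_ge0//.
  by move: h2; rewrite pmulr_rle0// subr_le0.
(* [Q] is what remains of [s] times the gap once [cheb] bounds [Y * U2 + X * V2] and [hS2] bounds
   [s * S2] from below. *)
pose Q := (X + Y) * W * (k * A ^+ 2 - S ^+ 2)
   - k * s * W * (Y * U ^+ 2 / u + X * V ^+ 2 / v) + (k + 1) * s * (Y * U + X * V) ^+ 2.
have Q0 : 0 <= Q.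
  have [uv|uv] := eqVneq u v.
    have XeY := uvXY uv.
    suff -> : Q = 0 by [].
    rewrite /Q /W /s /S /A XeY uv; field.
    by rewrite gt_eqF.
  have a0 : 0 < a by rewrite divr_gt0// subr_gt0 lt_neqAle eq_sym uv.
  rewrite -(pmulr_rge0 _ a0).
  (* The gap in [E], divided by [u * v]. *)
  pose e := X ^+ 2 - Y ^+ 2 - k * (X * Y) * (u ^+ 2 - v ^+ 2) / (u * v).
  have e0 : 0 <= e.
    rewrite /e subr_ge0 ler_pdivrMr ?mulr_gt0//.
    by move: E; rewrite !expr2 !mulrA.
  (* Here [a * S - s * A = (u V - v U) / 2], and the factor of [W] in the second coefficient is half
     the gap in [T]. *)
  suff -> : a * Q = e * (a * S - s * A) ^+ 2 +
     W * (k * a * (X + Y) - s * (X - Y)) * A ^+ 2.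
    have h : 0 <= k * a * (X + Y) - s * (X - Y).
      rewrite (_ : _ - _ = (k * ((u - v) * (X + Y)) - (X - Y) * (u + v)) / 2).
        by rewrite divr_ge0// subr_ge0.
      by rewrite /a /s; field.
    apply: addr_ge0; first by rewrite mulr_ge0// sqr_ge0.
    by rewrite mulr_ge0 ?sqr_ge0// mulr_ge0// ltW.
  rewrite /Q /e /W /s /S /A /a; field.
  by rewrite !gt_eqF.
rewrite -subr_gt0 -(pmulr_rgt0 _ s0).
set z := s * _.
have -> : z = Q + W * (X + Y) * (s * S2 + S ^+ 2 - k * A ^+ 2)
              + s * W * (Y * U2 + X * V2 - (X + Y) * S2).
  rewrite /z /Q; ring.
rewrite ltr_wpDr//.
  by rewrite mulr_ge0// ?subr_ge0// mulr_ge0// ltW.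
by rewrite ltr_wpDl// mulr_gt0// mulr_gt0// addr_gt0.
Qed.

(** Hypotheses and conclusion are invariant under exchanging [(u, U, U2)] with [(v, V, V2)], so one
    may order [u] and [v]. *)
Lemma harmonic_form k (u v U V U2 V2 : R) : (0 < k)%N -> 0 < u -> 0 < v ->
  (u - v) * (U2 - V2) <= 0 ->
  ((U - V) / 2) ^+ 2
    < k%:R^-1 * ((u + v) / 2 * ((U2 + V2) / 2) + ((U + V) / 2) ^+ 2) ->
  (u * v ^+ k + v * u ^+ k) *
    (k%:R * (v ^+ k * U ^+ 2 / u + u ^+ k * V ^+ 2 / v)
     - (v ^+ k * U2 + u ^+ k * V2))
  < k.+1%:R * (v ^+ k * U + u ^+ k * V) ^+ 2.
Proof.
move=> k0 u0 v0 h2 h1; have [vu|/ltW uv] := leP v u.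
  exact: harmonic_form_ordered.
rewrite (addrC (u * _)) [v ^+ k * U ^+ 2 / u + _]addrC [v ^+ k * U2 + _]addrC.
rewrite [v ^+ k * U + _]addrC; apply: harmonic_form_ordered => //.
  by rewrite -opprB mulNr -mulrN opprB.
by rewrite (addrC v) (addrC V2) [V + U]addrC -(sqrrN ((V - U) / 2)) -mulNr opprB.
Qed.

End PowerInequalities.

(** * Differentiability, the chain rule and real powers *)

Section Diff.
Context (R : realType).

(** The first-order expansion of [f] at [a] is also one of [g], and uniqueness of the differential
    identifies its linear part. *)
Lemma near_eq_differentiable (V W : normedModType R) (f g : V -> W) (a : V) :
  {near a, f =1 g} -> differentiable f a -> differentiable g a.
Proof.
move=> fg df.
have [dfc dfo] := (diff_locallyP _ _).1 df.
have go : g \o shift a = cst (g a) + 'd f a +o_ 0 id.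
  apply/eqaddoP => e e0.
  have /eqaddoP/(_ e e0) := dfo.
  have: \forall x \near 0, f (x + a) = g (x + a)
    by rewrite (near_shift a 0)/=; near do rewrite /= sub0r addrNK//.
  move=> h1 h2; near=> x.
  rewrite !fctE /=.
  rewrite -(near h1 x)// -(nbhs_singleton fg).
  by near: x.
apply/diff_locallyP; have -> : 'd g a = 'd f a :> (V -> W).
  by apply: diff_unique.
by split.
Unshelve. all: by end_near. Qed.

Lemma derive_comp (U V W : normedModType R) (f : U -> V) (g : V -> W) x v :
  differentiable f x -> differentiable g (f x) ->
  'D_v (g \o f) x = 'D_('D_v f x) g (f x).
Proof.
move=> df dg.
rewrite (deriveE v (differentiable_comp df dg)) (deriveE v df) (deriveE _ dg).
by rewrite (diff_comp df dg).
Qed.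

Lemma differentiable_powR (c x : R) : 0 < x ->
  differentiable (fun z : R => z `^ c) x.
Proof.
move=> x0; apply/derivable1_diffP.
exact: (@ex_derive _ _ _ _ _ _ _ (is_derive1_powR c x0)).
Qed.

Lemma differentiable_powR_comp (V : normedModType R) (f : V -> R) c x :
  differentiable f x -> 0 < f x -> differentiable (fun y => f y `^ c) x.
Proof.
move=> df f0.
change (differentiable ((fun z : R => z `^ c) \o f) x).
apply: differentiable_comp => //; exact: differentiable_powR.
Qed.

Lemma derive_powR_comp (V : normedModType R) (f : V -> R) c x v :
  differentiable f x -> 0 < f x ->
  'D_v (fun y => f y `^ c) x = c * f x `^ (c - 1) * 'D_v f x.
Proof.
move=> df f0.
have D := @is_derive1_powR R c _ f0.
have D' := @differentiable_powR c _ f0.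
have -> : 'D_v (fun y => f y `^ c) x = 'D_('D_v f x) (fun z : R => z `^ c) (f x).
  exact: derive_comp.
rewrite (deriveE _ D').
rewrite -[X in 'd _ _ X]mulr1 [LHS]linearZ/= -(deriveE _ D') derive_val.
by rewrite [LHS]mulrC.
Qed.

End Diff.

(** * Closure properties of C^k functions on an open set *)

Section Ck.
Context (R : realType) (V : normedModType R) (A : set V).
Hypothesis oA : open A.
Implicit Types (f g : V -> R) (k : nat).

Lemma near_open_eq f g p : (forall q, A q -> f q = g q) -> A p ->
  \near p, f p = g p.
Proof.
move=> fg Ap; apply: filterS (open_nbhs_nbhs (conj oA Ap)) => q; exact: fg.
Qed.

(** As [A] is open, equality on [A] is equality near each of its points and so passes to
    derivatives. This lets formulas valid only on [A] be substituted. *)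
Lemma eq_is_Ck k f g : (forall q, A q -> f q = g q) ->
  is_Ck k A f -> is_Ck k A g.
Proof.
elim: k f g => [|k IH] f g fg /=.
  move=> cf p Ap; have fgp := near_open_eq fg Ap.
  rewrite /prop_for /continuous_at -(fg p Ap).
  by apply: cvg_trans (cf p Ap); exact: near_eq_cvg.
move=> [df ckf]; split=> [p Ap|v].
  exact: near_eq_differentiable (near_open_eq fg Ap) (df p Ap).
apply: IH (ckf v) => q Aq.
exact/near_eq_derive/near_open_eq.
Qed.

Lemma is_CkS k f : is_Ck k.+1 A f -> is_Ck k A f.
Proof.
elim: k f => [|k IH] f [df ckf].
  by move=> p Ap; exact: differentiable_continuous (df p Ap).
by split=> // v; exact/IH/ckf.
Qed.

Lemma is_CkD k f g : is_Ck k A f -> is_Ck k A g ->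
  is_Ck k A (fun p => f p + g p).
Proof.
elim: k f g => [|k IH] f g /=.
  by move=> cf cg p Ap; apply: cvgD; [exact: cf|exact: cg].
move=> [df ckf] [dg ckg]; split=> [p Ap|v].
  by apply: differentiableD; [exact: df|exact: dg].
apply: eq_is_Ck (IH _ _ (ckf v) (ckg v)) => p Ap.
by rewrite -deriveD//; apply: diff_derivable; [exact: df|exact: dg].
Qed.

Lemma is_CkM k f g : is_Ck k A f -> is_Ck k A g ->
  is_Ck k A (fun p => f p * g p).
Proof.
elim: k f g => [|k IH] f g /=.
  by move=> cf cg p Ap; apply: cvgM; [exact: cf|exact: cg].
move=> Cf Cg; have [df ckf] := Cf; have [dg ckg] := Cg; split=> [p Ap|v].
  by apply: differentiableM; [exact: df|exact: dg].
have Cfg := is_CkD (IH _ _ (is_CkS Cf) (ckg v)) (IH _ _ (is_CkS Cg) (ckf v)).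
apply: eq_is_Ck Cfg => p Ap.
by rewrite -[LHS]deriveM//; apply: diff_derivable; [exact: df|exact: dg].
Qed.

Lemma is_Ck_cst k (c : R) : is_Ck k A (fun=> c).
Proof.
elim: k c => [|k IH] c /=; first by move=> p _; exact: cvg_cst.
split=> [p _|v]; first exact: differentiable_cst.
by apply: eq_is_Ck (IH 0) => p _; rewrite -(derive_cst c p v).
Qed.

Lemma is_CkZ k (c : R) f : is_Ck k A f -> is_Ck k A (fun p => c * f p).
Proof. exact/is_CkM/is_Ck_cst. Qed.

Lemma is_Ck_powR k f (c : R) : (forall p, A p -> 0 < f p) ->
  is_Ck k A f -> is_Ck k A (fun p => f p `^ c).
Proof.
(* The exponent is generalized because differentiation lowers it to [c - 1]. *)
move=> f0; elim: k c => [|k IH] c Cf /=.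
  move=> p Ap; apply: (@cvg_comp _ _ _ f (fun z : R => z `^ c)); first exact: Cf.
  exact: (differentiable_continuous (differentiable_powR c (f0 _ Ap))).
have [df ckf] := Cf; split=> [p Ap|v].
  by apply: differentiable_powR_comp; [exact: df|exact: f0].
apply: eq_is_Ck (is_CkM (is_CkZ c (IH (c - 1) (is_CkS Cf))) (ckf v)) => p Ap.
by rewrite derive_powR_comp//; [exact: df|exact: f0].
Qed.

End Ck.

(** The differential [l] is the same at every point, so [L] is affine and the derivative of [f \o L]
    along [v] is ['D_(l v) f \o L], again a composite with [L]. This closes the induction. *)
Lemma is_Ck_comp (R : realType) (U V : normedModType R) (L : U -> V) (l : U -> V)
    (A : set V) k (f : V -> R) :
  (forall x, is_diff x L l) -> open A ->
  is_Ck k A f -> is_Ck k (L @^-1` A) (f \o L).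
Proof.
move=> dL oA.
have dL' x : differentiable L x by exact: ex_diff.
have oB : open (L @^-1` A).
  by apply: open_comp => // x _; exact: differentiable_continuous.
elim: k f => [|k IH] f /=.
  move=> cf p Ap; apply: continuous_comp; last exact: cf.
  exact: differentiable_continuous.
move=> [df ckf]; split=> [p Ap|v].
  by apply: differentiable_comp => //; exact: df.
apply: (eq_is_Ck oB) (IH _ (ckf (l v))) => p Ap /=.
rewrite [RHS](derive_comp v (dL' p) (df _ Ap)).
by rewrite (deriveE v (dL' p)) diff_val.
Qed.

(** The second derivative of [a^c] along a line where [a] has first and second derivatives [a1] and
    [a2]. *)
Definition powR_d2 (R : realType) (c a a1 a2 : R) : R :=
  c * (c - 1) * a `^ (c - 1 - 1) * a1 ^+ 2 + c * a `^ (c - 1) * a2.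

(** * Second directional derivatives *)

Section SecondDerivative.
Context (R : realType) (V : normedModType R) (A : set V).
Hypothesis oA : open A.
Implicit Types (f g : V -> R) (w y : V).

Lemma is_C2_derivable f y w : is_Ck 2 A f -> A y ->
  derivable f y w /\ derivable ('D_w f) y w.
Proof.
move=> [df ckf] Ay; split; apply: diff_derivable; first exact: df.
by have [+ _] := ckf w; apply.
Qed.

Lemma derive2D f g y w : is_Ck 2 A f -> is_Ck 2 A g -> A y ->
  'D_w ('D_w (fun z => f z + g z)) y = 'D_w ('D_w f) y + 'D_w ('D_w g) y.
Proof.
move=> Cf Cg Ay.
have [_ df] := is_C2_derivable w Cf Ay; have [_ dg] := is_C2_derivable w Cg Ay.
rewrite -deriveD//; apply/near_eq_derive/(near_open_eq oA _ Ay) => q Aq.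
have [dfq _] := is_C2_derivable w Cf Aq; have [dgq _] := is_C2_derivable w Cg Aq.
exact: deriveD.
Qed.

Lemma derive2Z c f y w : is_Ck 2 A f -> A y ->
  'D_w ('D_w (fun z => c * f z)) y = c * 'D_w ('D_w f) y.
Proof.
move=> Cf Ay; have [_ df] := is_C2_derivable w Cf Ay.
rewrite -[RHS](deriveZ c df).
apply/near_eq_derive/(near_open_eq oA _ Ay) => q Aq.
have [dfq _] := is_C2_derivable w Cf Aq.
exact: deriveZ.
Qed.

Lemma derive2_powR c f y w : (forall p, A p -> 0 < f p) ->
  is_Ck 2 A f -> A y ->
  'D_w ('D_w (fun z => f z `^ c)) y =
  powR_d2 c (f y) ('D_w f y) ('D_w ('D_w f) y).
Proof.
move=> f0 Cf Ay; have [dfd df2] := Cf; have [_ df] := is_C2_derivable w Cf Ay.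
transitivity ('D_w (c *: ((fun z => f z `^ (c - 1)) * 'D_w f)) y).
  apply/near_eq_derive/(near_open_eq oA _ Ay) => q Aq.
  rewrite derive_powR_comp; [|exact: dfd|exact: f0].
  by rewrite -mulrA.
have dp : derivable (fun z => f z `^ (c - 1)) y w.
  by apply/diff_derivable/differentiable_powR_comp; [exact: dfd|exact: f0].
rewrite deriveZ; last exact: derivableM.
rewrite deriveM// derive_powR_comp; [|exact: dfd|exact: f0].
rewrite /powR_d2 /GRing.scale/=; ring.
Qed.

Lemma derive2_half_sqr f y w : is_Ck 2 A f -> A y ->
  'D_w ('D_w (fun z => f z ^+ 2 / 2)) y = f y * 'D_w ('D_w f) y + 'D_w f y ^+ 2.
Proof.
move=> Cf Ay; have [df1 df2] := is_C2_derivable w Cf Ay.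
transitivity ('D_w (f * 'D_w f) y).
  apply/near_eq_derive/(near_open_eq oA _ Ay) => q Aq.
  have [dfq _] := is_C2_derivable w Cf Aq.
  have -> : (fun z => f z ^+ 2 / 2) = 2^-1 *: (f * f).
    by apply/funext => z; rewrite mulrC expr2.
  rewrite deriveZ; last exact: derivableM.
  by rewrite deriveM// /GRing.scale/= fctE; field.
by rewrite deriveM.
Qed.

Lemma is_Ck_half_sqr k f : is_Ck k A f -> is_Ck k A (fun z => f z ^+ 2 / 2).
Proof.
move=> Cf; apply: (eq_is_Ck oA) (is_CkZ oA 2^-1 (is_CkM oA Cf Cf)) => z _.
by rewrite [RHS]mulrC expr2.
Qed.

Lemma derive_lincomb (a b : R) f g y w : derivable f y w -> derivable g y w ->
  'D_w (fun z => a * f z + b * g z) y = a * 'D_w f y + b * 'D_w g y.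
Proof.
move=> df dg.
rewrite -[a * _](deriveZ a df) -[b * _](deriveZ b dg).
by rewrite -deriveD//; exact: derivableZ.
Qed.

Lemma is_Ck_lincomb k (a b : R) f g : is_Ck k A f -> is_Ck k A g ->
  is_Ck k A (fun z => a * f z + b * g z).
Proof. by move=> Cf Cg; apply: is_CkD => //; apply: is_CkZ. Qed.

Lemma derive2_lincomb (a b : R) f g y w : is_Ck 2 A f -> is_Ck 2 A g -> A y ->
  'D_w ('D_w (fun z => a * f z + b * g z)) y =
  a * 'D_w ('D_w f) y + b * 'D_w ('D_w g) y.
Proof.
move=> Cf Cg Ay.
by rewrite (derive2D w (is_CkZ oA a Cf) (is_CkZ oA b Cg) Ay) !derive2Z.
Qed.

End SecondDerivative.

(** * Hessians as quadratic forms *)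

Section Hessian.
Context (R : realType) (n : nat).
Implicit Types (f : 'rV[R]_n -> R) (y w : 'rV[R]_n).

Lemma derive_partialE f y w : differentiable f y ->
  'D_w f y = \sum_l partial l f y * w 0 l.
Proof.
move=> df; rewrite deriveE// {1}(row_sum_delta w) linear_sum/=.
apply: eq_bigr => l _; rewrite linearZ/= /partial deriveE//.
by rewrite [LHS]mulrC.
Qed.

(** Turns the matrix conditions into conditions on derivatives along a single direction [w]. *)
Lemma derive2_hessianE (A : set 'rV[R]_n) f y w : open A -> is_Ck 2 A f -> A y ->
  'D_w ('D_w f) y = \sum_i \sum_j hessian f y i j * w 0 i * w 0 j.
Proof.
move=> oA [df ckf] Ay.
have dpf i : differentiable (partial i f) y by have [+ _] := ckf (delta_mx 0 i); apply.
transitivity ('D_w (\sum_i (w 0 i *: partial i f)) y).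
  apply/near_eq_derive/(near_open_eq oA _ Ay) => q Aq.
  rewrite derive_partialE; last exact: df.
  by rewrite fct_sumE; apply: eq_bigr => i _; rewrite mulrC.
rewrite derive_sum; last first.
  by move=> i; apply/derivableZ/diff_derivable.
apply: eq_bigr => i _; rewrite deriveZ; last exact: diff_derivable.
rewrite derive_partialE// scaler_sumr; apply: eq_bigr => j _.
by rewrite mxE [LHS]mulrC mulrAC.
Qed.

Lemma quadratic_formZ (c : R) (B : 'M[R]_n) w :
  \sum_i \sum_j (c *: B) i j * w 0 i * w 0 j =
  c * \sum_i \sum_j B i j * w 0 i * w 0 j.
Proof.
rewrite mulr_sumr; apply: eq_bigr => i _; rewrite mulr_sumr.
by apply: eq_bigr => j _; rewrite mxE -!mulrA.
Qed.

End Hessian.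

(** * Openness of the domains with [y != 0] *)

Section Punctured.
Context (R : realType) (V : normedModType R).

Lemma open_neq0 : open [set y : V | y != 0].
Proof.
rewrite (_ : [set y : V | y != 0] = (fun y : V => `|y|) @^-1` [set r : R | r != 0]).
  apply: open_comp; last exact: open_neq.
  by move=> x _; exact: norm_continuous.
by apply/seteqP; split=> y /=; rewrite normr_eq0.
Qed.

Lemma open_snd_neq0 (U : normedModType R) : open [set p : U * V | p.2 != 0].
Proof.
apply: (@open_comp _ _ snd [set y : V | y != 0]); last exact: open_neq0.
by move=> x _; exact: cvg_snd.
Qed.

End Punctured.

(** * Slices, Euler's identity and positivity of a Finsler metric *)

Section FinslerBasics.
Context (R : realType) (n : nat) (F : 'rV[R]_n -> 'rV[R]_n -> R).
Hypothesis hF : finsler_metric F.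

Lemma finsler_slice k x : is_Ck k [set y | y != 0] (F x).
Proof.
have d (y : 'rV[R]_n) : is_diff y (fun z => (x, z)) (fun v => (0, v)).
  exact: (is_diff_pair (is_diff_cst x y) (is_diff_id y)).
exact: (is_Ck_comp d (@open_snd_neq0 _ _ _) (@finsler_smooth _ _ _ hF k)).
Qed.

Lemma finsler_slice_opp k x : is_Ck k [set y | y != 0] (fun y => F x (- y)).
Proof.
have d (y : 'rV[R]_n) : is_diff y -%R -%R.
  by apply: (is_diffN (is_diff_id y)).
have := is_Ck_comp d (@open_neq0 _ _) (@finsler_slice k x).
rewrite (_ : -%R @^-1` _ = [set y : 'rV[R]_n | y != 0])//.
by apply/seteqP; split=> y /=; rewrite oppr_eq0.
Qed.

Lemma finsler_opp_smooth :
  smooth_on [set p : 'rV[R]_n * 'rV[R]_n | p.2 != 0] (fun p => F p.1 (- p.2)).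
Proof.
move=> k.
have d (p : 'rV[R]_n * 'rV[R]_n) :
    is_diff p (fun q => (q.1, - q.2)) (fun q => (q.1, - q.2)).
  apply: is_diff_pair.
    by apply: DiffDef; [apply: linear_differentiable|rewrite diff_lin//] => // ?;
      exact: cvg_fst.
  apply: (is_diffN (f := snd)).
  by apply: DiffDef; [apply: linear_differentiable|rewrite diff_lin//] => // ?;
    exact: cvg_snd.
have := is_Ck_comp d (@open_snd_neq0 _ _ _) (@finsler_smooth _ _ _ hF k).
rewrite (_ : _ @^-1` _ = [set p : 'rV[R]_n * 'rV[R]_n | p.2 != 0])//.
by apply/seteqP; split=> y /=; rewrite oppr_eq0.
Qed.

(** Euler's identity: differentiate [F x (t *: y) = t * F x y] at [t = 1]. *)
Lemma finsler_euler x (y : 'rV[R]_n) : y != 0 -> 'D_y (F x) y = F x y.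
Proof.
move=> y0; have [dF _] := @finsler_slice 1 x.
have d : is_diff (1 : R) (fun t : R => t *: y) (fun t : R => t *: y).
  exact: is_diff_scalel.
have dd : differentiable (fun t : R => t *: y) (1 : R) by exact: ex_diff.
have D1 : 'D_1 (fun t : R => t *: y) (1 : R) = y.
  by rewrite (deriveE _ dd) diff_val scale1r.
have dFy : differentiable (F x) ((1 : R) *: y) by rewrite scale1r; exact: dF.
have := derive_comp (1 : R) dd dFy; rewrite D1 scale1r => <-.
(* Homogeneity is available for [t > 0] only, which covers a neighbourhood of 1. *)
transitivity ('D_1 (F x y \*o id) (1 : R)).
  apply: near_eq_derive; near=> t; rewrite /= [RHS]mulrC; apply: (finsler_homog hF).
  near: t; exact: lt_nbhsr.
by rewrite deriveMl// derive_id mulr1.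
Unshelve. all: by end_near. Qed.

(** If [F x y = 0], the second derivative of [F^2 / 2] at [y] along [y] itself is [F F'' + F'^2]
    with [F' = F = 0] by Euler's identity, against positive definiteness. *)
Lemma finsler_gt0 x (y : 'rV[R]_n) : y != 0 -> 0 < F x y.
Proof.
move=> y0; rewrite lt_neqAle (finsler_ge0 hF) andbT eq_sym; apply/eqP => F0.
have C2 := @finsler_slice 2 x.
have := finsler_posdef hF x y0 y0; rewrite /fundamental_tensor.
rewrite -(derive2_hessianE _ (@open_neq0 _ _) (is_Ck_half_sqr (@open_neq0 _ _) C2) y0).
rewrite (derive2_half_sqr (@open_neq0 _ _) _ C2 y0) finsler_euler// F0.
by rewrite mul0r expr0n addr0 ltxx.
Qed.

End FinslerBasics.

(** * The harmonic mean and the sign of its second derivative *)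

Section HarmonicMean.
Context (R : realType).
Implicit Types (u v : R).

(** Rewrites the mean as [phi^(-1/m)] in real powers, so that the power rule applies throughout. *)
Lemma powR_harmonic m u v : 0 < u -> 0 < v ->
  (2 / (u ^- m + v ^- m)) `^ (m%:R^-1) =
  (2^-1 * u `^ (- m%:R) + 2^-1 * v `^ (- m%:R)) `^ (- m%:R^-1).
Proof.
move=> u0 v0; rewrite !powR_invn ?ltW// -mulrDr.
have p0 : 0 < u ^- m + v ^- m by rewrite addr_gt0// invr_gt0 exprn_gt0.
by rewrite -[- m%:R^-1]mulN1r powRrM powR_inv1 ?mulr_ge0 ?(ltW p0)// invfM invrK.
Qed.

(** The positive factor [- c * a^(c - 2)] splits off. For [c = -2/m] the constant [1 - c] is
    [1 + 2/m]. *)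
Lemma powR_d2_gt0 (c a a1 a2 : R) : 0 < a -> c < 0 ->
  a * a2 < (1 - c) * a1 ^+ 2 -> 0 < powR_d2 c a a1 a2.
Proof.
move=> a0 c0 h; rewrite /powR_d2.
have -> : a `^ (c - 1) = a `^ (c - 1 - 1) * a.
  by rewrite -[X in _ * X]powRr1 ?(ltW a0)// -powRD ?subrK// (gt_eqF a0) implybT.
have p0 : 0 < a `^ (c - 1 - 1) by rewrite powR_gt0.
rewrite (_ : _ + _ = a `^ (c - 1 - 1) * (- c * ((1 - c) * a1 ^+ 2 - a * a2))).
  by rewrite mulr_gt0// mulr_gt0 ?oppr_gt0// subr_gt0.
ring.
Qed.

Lemma harmonic_sq_convex m u v U V U2 V2 (c := - m%:R : R) :
  (0 < m)%N -> 0 < u -> 0 < v ->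
  (2^-1 * (u - v)) * (2^-1 * (U2 - V2)) <= 0 ->
  (2^-1 * (U - V)) ^+ 2
    < m.+1%:R^-1 * ((2^-1 * (u + v)) * (2^-1 * (U2 + V2)) + (2^-1 * (U + V)) ^+ 2) ->
  0 < powR_d2 (- m%:R^-1 * 2) (2^-1 * u `^ c + 2^-1 * v `^ c)
    (2^-1 * (c * u `^ (c - 1) * U) + 2^-1 * (c * v `^ (c - 1) * V))
    (2^-1 * powR_d2 c u U U2 + 2^-1 * powR_d2 c v V V2).
Proof.
move=> m0 u0 v0 h2 h1.
have m0' : 0 < m%:R :> R by rewrite ltr0n.
have H : (u * v ^+ m.+1 + v * u ^+ m.+1) *
    (m.+1%:R * (v ^+ m.+1 * U ^+ 2 / u + u ^+ m.+1 * V ^+ 2 / v)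
     - (v ^+ m.+1 * U2 + u ^+ m.+1 * V2))
  < m.+2%:R * (v ^+ m.+1 * U + u ^+ m.+1 * V) ^+ 2.
  apply: harmonic_form => //.
    by move: h2; rewrite mulrACA pmulr_rle0// mulr_gt0.
  by rewrite ![_ / 2]mulrC.
(* All real powers are expressed through [z ^+ m.+1], the only power occurring in [H]. *)
have pE (z : R) (z0 : 0 < z) : [/\ z `^ c = z / z ^+ m.+1, z `^ (c - 1) = (z ^+ m.+1)^-1
    & z `^ (c - 1 - 1) = (z ^+ m.+1 * z)^-1].
  split; rewrite /c -?opprD ?natr1 powR_invn ?(ltW z0)//.
    by rewrite exprS invfM mulrA divff ?gt_eqF// mul1r.
  by rewrite exprSr.
apply: powR_d2_gt0.
- by rewrite addr_gt0// mulr_gt0// powR_gt0.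
- by rewrite nmulr_rlt0// oppr_lt0 invr_gt0.
rewrite /powR_d2; have [-> -> ->] := pE u u0; have [-> -> ->] := pE v v0.
have X0 : 0 < u ^+ m.+1 by rewrite exprn_gt0.
have Y0 : 0 < v ^+ m.+1 by rewrite exprn_gt0.
move: H; rewrite /c -!natr1; move: (u ^+ m.+1) (v ^+ m.+1) X0 Y0 => X Y X0 Y0.
move: (m%:R : R) m0' => M M0.
(* Multiplying [H] by this factor makes its gap equal to that of the goal. *)
have K0 : 0 < M / (2 * X * Y) ^+ 2 by rewrite divr_gt0// exprn_gt0// !mulr_gt0.
rewrite -(ltr_pM2l K0) => H.
rewrite -subr_gt0; move: H; rewrite -subr_gt0.
congr (is_true (0 < _)).
field.
by rewrite !gt_eqF.
Qed.

End HarmonicMean.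

(** * The Finsler axioms for the harmonic symmetrization *)

Section HarmonicSym.
Context (R : realType) (m : nat) (F : 'rV[R]_m.+1 -> 'rV[R]_m.+1 -> R).
Hypotheses (hm : (0 < m)%N) (hF : finsler_metric F).
Let V := 'rV[R]_m.+1.
Implicit Types (x y w : V).

Lemma finsler_opp_gt0 x y : y != 0 -> 0 < F x (- y).
Proof. by move=> y0; rewrite finsler_gt0// oppr_eq0. Qed.

Lemma harmonic_symE x y : y != 0 -> harmonic_sym F x y =
  (2^-1 * F x y `^ (- m%:R) + 2^-1 * F x (- y) `^ (- m%:R)) `^ (- m%:R^-1).
Proof.
by move=> y0; rewrite /harmonic_sym (negPf y0) powR_harmonic
  ?finsler_opp_gt0 ?finsler_gt0.
Qed.

Lemma harmonic_sym_homog x y (t : R) : 0 < t ->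
  harmonic_sym F x (t *: y) = t * harmonic_sym F x y.
Proof.
move=> t0; have [->|y0] := eqVneq y 0.
  by rewrite scaler0 /harmonic_sym eqxx mulr0.
have u0 := finsler_gt0 hF x y0; have v0 := finsler_opp_gt0 x y0.
have p0 : 0 < F x y ^- m + F x (- y) ^- m by rewrite addr_gt0// invr_gt0 exprn_gt0.
rewrite /harmonic_sym scaler_eq0 gt_eqF//= (negPf y0) -scalerN !(finsler_homog hF)//.
rewrite !exprMn !invfM -mulrDr invfM invrK mulrCA.
rewrite powRM ?exprn_ge0 ?(ltW t0)//; last first.
  by rewrite divr_ge0// ltW.
(* The root undoes the power, [(t^m)^(1/m) = t], since [m] is nonzero. *)
by rewrite -[t ^+ m]powR_mulrn ?(ltW t0)// -powRrM divff
  ?powRr1 ?(ltW t0)// pnatr_eq0 -lt0n.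
Qed.

Lemma harmonic_sym_smooth :
  smooth_on [set p : V * V | p.2 != 0] (fun p => harmonic_sym F p.1 p.2).
Proof.
move=> k; have oA := @open_snd_neq0 R V V.
apply: (eq_is_Ck oA (fun p p0 => esym (harmonic_symE p.1 p0))).
apply: is_Ck_powR => //.
  by move=> p p0; rewrite addr_gt0// mulr_gt0// powR_gt0//
    ?finsler_opp_gt0 ?finsler_gt0.
apply: is_Ck_lincomb => //; apply: is_Ck_powR => //.
- by move=> p p0; exact: finsler_gt0.
- exact: (finsler_smooth hF).
- by move=> p p0; exact: finsler_opp_gt0.
- exact: finsler_opp_smooth.
Qed.

Let A := [set y : V | y != 0].
Let oA : open A := @open_neq0 R V.

Lemma antisym_partE x : antisym_part F x =
  (fun y => 2^-1 * F x y + (- 2^-1) * F x (- y)).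
Proof. by apply/funext => y; rewrite /antisym_part mulrBr mulNr. Qed.

Lemma sym_partE x : sym_part F x = (fun y => 2^-1 * F x y + 2^-1 * F x (- y)).
Proof. by apply/funext => y; rewrite /sym_part mulrDr. Qed.

Lemma harmonic_sym_posdef x y : y != 0 ->
  (forall w, w != 0 ->
     (\sum_l partial l (antisym_part F x) y * w 0 l) ^+ 2
     < (m.+1)%:R^-1 *
       \sum_i \sum_j fundamental_tensor (sym_part F) x y i j * w 0 i * w 0 j) ->
  negsemidef (antisym_part F x y *: hessian (antisym_part F x) y) ->
  posdef (fundamental_tensor (harmonic_sym F) x y).
Proof.
move=> y0 hgrad hneg w w0.
pose u : V -> R := F x; pose v : V -> R := fun z => F x (- z).
have Cu : is_Ck 2 A u by exact: finsler_slice.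
have Cv : is_Ck 2 A v by exact: finsler_slice_opp.
have u0 z : A z -> 0 < u z by exact: finsler_gt0.
have v0 z : A z -> 0 < v z by exact: finsler_opp_gt0.
have [du1 _] := is_C2_derivable w Cu y0; have [dv1 _] := is_C2_derivable w Cv y0.
have Ca : is_Ck 2 A (antisym_part F x).
  by rewrite antisym_partE; exact: (is_Ck_lincomb oA _ _ Cu Cv).
have Cs : is_Ck 2 A (sym_part F x).
  by rewrite sym_partE; exact: (is_Ck_lincomb oA _ _ Cu Cv).
(* Both matrix hypotheses are evaluated on [w], giving scalar inequalities in the derivatives of [u]
   and [v] along [w]. *)
have {hneg} : antisym_part F x y * 'D_w ('D_w (antisym_part F x)) y <= 0.
  rewrite (derive2_hessianE w oA Ca y0) -quadratic_formZ; exact: hneg.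
have {hgrad} : 'D_w (antisym_part F x) y ^+ 2 < m.+1%:R^-1 *
    (sym_part F x y * 'D_w ('D_w (sym_part F x)) y + 'D_w (sym_part F x) y ^+ 2).
  rewrite -(derive2_half_sqr oA w Cs y0).
  rewrite (derive2_hessianE w oA (is_Ck_half_sqr oA Cs) y0).
  by have [dCa _] := Ca; rewrite (derive_partialE w (dCa y y0)); exact: hgrad.
move=> hgrad hneg.
pose c : R := - m%:R.
pose phi z := 2^-1 * u z `^ c + 2^-1 * v z `^ c.
have Cpu : is_Ck 2 A (fun z => u z `^ c) by exact: (is_Ck_powR oA).
have Cpv : is_Ck 2 A (fun z => v z `^ c) by exact: (is_Ck_powR oA).
have Cphi : is_Ck 2 A phi by exact: (is_Ck_lincomb oA).
have phi0 z : A z -> 0 < phi z.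
  move=> Az; rewrite /phi.
  by rewrite addr_gt0// mulr_gt0// powR_gt0//; [exact: u0|exact: v0].
(* Squaring [phi^(-1/m)] gives [phi^(-2/m)]. The formula holds off the origin, an open set, so it
   may be differentiated twice there. *)
have HE z : A z -> 2^-1 * phi z `^ (- m%:R^-1 * 2) = harmonic_sym F x z ^+ 2 / 2.
  move=> Az; rewrite harmonic_symE// mulrC powRrM.
  by rewrite powR_mulrn ?powR_ge0.
have Cp : is_Ck 2 A (fun z => phi z `^ (- m%:R^-1 * 2)) by exact: (is_Ck_powR oA).
have CH := eq_is_Ck oA HE (is_CkZ oA 2^-1 Cp).
rewrite /fundamental_tensor -(derive2_hessianE w oA CH y0).
have -> : 'D_w ('D_w (fun z => harmonic_sym F x z ^+ 2 / 2)) y =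
    'D_w ('D_w (fun z => 2^-1 * phi z `^ (- m%:R^-1 * 2))) y.
  apply/esym/near_eq_derive/(near_open_eq oA _ y0) => q Aq.
  exact/near_eq_derive/(near_open_eq oA HE).
rewrite (derive2Z oA _ w Cp y0) mulr_gt0//.
rewrite (derive2_powR oA _ w phi0 Cphi y0).
rewrite (derive2_lincomb oA _ _ w Cpu Cpv y0).
have [dpu _] := is_C2_derivable w Cpu y0; have [dpv _] := is_C2_derivable w Cpv y0.
rewrite (derive_lincomb _ _ dpu dpv) (derive2_powR oA c w u0 Cu y0)
  (derive2_powR oA c w v0 Cv y0).
have [du _] := Cu; have [dv _] := Cv.
rewrite (derive_powR_comp c w (du y y0) (u0 y y0)).
rewrite (derive_powR_comp c w (dv y y0) (v0 y y0)).
apply: harmonic_sq_convex => //; [exact: u0|exact: v0| |].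
  move: hneg; rewrite antisym_partE (derive2_lincomb oA _ _ w Cu Cv y0).
  by rewrite !mulNr -!mulrBr.
move: hgrad; rewrite antisym_partE sym_partE !(derive_lincomb _ _ du1 dv1).
rewrite (derive2_lincomb oA _ _ w Cu Cv y0).
by rewrite !mulNr -!mulrBr -!mulrDr.
Qed.

End HarmonicSym.

Theorem theorem1p5 (R : realType) (m : nat) (hm : (0 < m)%N)
    (F : 'rV[R]_m.+1 -> 'rV[R]_m.+1 -> R) (hF : finsler_metric F)
    (hgrad : forall x y : 'rV[R]_m.+1, y != 0 ->
       forall w : 'rV[R]_m.+1, w != 0 ->
         (\sum_l partial l (antisym_part F x) y * w 0 l) ^+ 2
         < (m.+1)%:R^-1 *
           \sum_i \sum_j fundamental_tensor (sym_part F) x y i j * w 0 i * w 0 j)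
    (hneg : forall x y : 'rV[R]_m.+1, y != 0 ->
       negsemidef (antisym_part F x y *: hessian (antisym_part F x) y)) :
  finsler_metric (harmonic_sym F).
Proof.
split.
- by move=> x y; rewrite /harmonic_sym; case: eqP => // _; exact: powR_ge0.
- exact: harmonic_sym_smooth.
- by move=> x; rewrite /harmonic_sym eqxx.
- by move=> x y t; exact: harmonic_sym_homog.
- move=> x y y0; apply: harmonic_sym_posdef => //; first exact: hgrad.
  exact: hneg.
Qed.
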